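(* Let $R$ be a principal ideal domain such that $R/\mathfrak{m}$ is finite for every maximal ideal $\mathfrak{m}$ of $R$. Then $R$ has enough homogeneous polynomials.
   Context: Let $R$ be a commutative ring with identity. An $n$-tuple $\langle x_1,\dots,x_n\rangle\in R^n$ has coprime entries if the ideal $(x_1,\dots,x_n)$ equals $R$. The ring $R$ has enough homogeneous polynomials if for every $n\geq 1$ and every finite set $S\subseteq R^n$ of points with coprime entries, there is a nonconstant homogeneous polynomial $f\in R[x_1,\dots,x_n]$ such that $f(X)$ is a unit of $R$ for each $X\in S$. Here ''nonconstant homogeneous'' means homogeneous of some degree $d\geq 1$, i.e. an $R$-linear combination of monomials of total degree exactly $d$ (the zero polynomial counts as homogeneous of every degree, which matters only when $R$ is the zero ring). *)

(* Defs.v *)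
From HB Require Import structures.
From mathcomp Require Import all_boot all_order all_algebra.
From mathcomp Require Import ring_quotient finmap mpoly.

Set Implicit Arguments.
Unset Strict Implicit.
Unset Printing Implicit Defensive.

Import GRing.Theory.
Local Open Scope ring_scope.

(* Unlike idealr, this also allows the unit ideal. Ideals are boolean
   predicates, as in ring_quotient. *)
Definition is_ideal (R : comNzRingType) (I : {pred R}) : Prop :=
  zmod_closed I /\ (forall a x : R, x \in I -> a * x \in I).

(* Integrality is carried by idomainType. *)
Definition is_PID (R : idomainType) : Prop :=
  forall I : {pred R}, is_ideal I ->
  exists a : R, forall x : R, (x \in I) <-> (exists b : R, x = b * a).

(* Elements of idealr R are proper (1 \notin m). *)
Definition maximal_ideal (R : comNzRingType) (m : idealr R) : Prop :=
  forall J : idealr R, {subset m <= J} -> {subset J <= m}.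

Definition finite_quotient (R : comNzRingType) (m : idealr R) : Prop :=
  exists e : seq {ideal_quot m}, Finite.axiom e.

Definition ideal_generated (R : comNzRingType) (n : nat) (x : n.-tuple R)
    (r : R) : Prop :=
  exists a : n.-tuple R, r = \sum_(i < n) tnth a i * tnth x i.

Definition coprime_entries (R : comNzRingType) (n : nat) (x : n.-tuple R) :
    Prop :=
  forall r : R, ideal_generated x r.

Definition enough_homogeneous_polynomials (R : comUnitRingType) : Prop :=
  forall n : nat, (1 <= n)%N ->
  forall S : {fset n.-tuple R},
  (forall x : n.-tuple R, x \in S -> coprime_entries x) ->
  exists (d : nat) (f : {mpoly R[n]}),
    [/\ (1 <= d)%N, f \is d.-homog &
        forall x : n.-tuple R, x \in S -> f.@[tnth x] \is a GRing.unit].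

(* Main.v *)
(* Induction on the finite set of points. Let [f] take unit values at the
   points [x] of [s], and let [y] be a further point. For each [x] the values at
   [y] of the linear forms vanishing at [x] form an ideal [(b)], and modulo [b]
   the point [y] is a unit multiple of [x]; hence [f(y)] is invertible modulo
   [b]. Multiplying such forms over [s] gives a form [g] that vanishes on [s],
   with [f(y)] invertible modulo [a = g(y)]. If [a = 0] then [f] already works.
   Otherwise finiteness of the residue fields yields [f(y)^k = 1 + c a] for some
   large [k], and [f^k - c g l^e] works for a linear form [l] with [l(y) = 1]. *)
Require Import Defs.
From HB Require Import structures.
From mathcomp Require Import all_boot all_order all_algebra.
From mathcomp Require Import ring_quotient finmap mpoly.
From mathcomp Require Import boolp ring.

Set Implicit Arguments.
Unset Strict Implicit.
Unset Printing Implicit Defensive.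

Import GRing.Theory.
Local Open Scope ring_scope.

(** * Divisibility, comaximality and torsion modulo an element *)

Section Divisibility.
Variable R : idomainType.
Implicit Types a b c u v x y : R.

Definition dvdr a x : Prop := exists c, x = c * a.

Definition comaximal u a : Prop := exists r s, r * u + s * a = 1.

Lemma dvdr0 a : dvdr a 0.
Proof. by exists 0; rewrite mul0r. Qed.

Lemma dvdrr a : dvdr a a.
Proof. by exists 1; rewrite mul1r. Qed.

Lemma dvdr_trans b a x : dvdr a b -> dvdr b x -> dvdr a x.
Proof. by move=> [c ->] [d ->]; exists (d * c); rewrite mulrA. Qed.

Lemma dvdrD a x y : dvdr a x -> dvdr a y -> dvdr a (x + y).
Proof. by move=> [c ->] [d ->]; exists (c + d); rewrite mulrDl. Qed.

Lemma dvdrB a x y : dvdr a x -> dvdr a y -> dvdr a (x - y).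
Proof. by move=> [c ->] [d ->]; exists (c - d); rewrite mulrBl. Qed.

Lemma dvdr_mull a c x : dvdr a x -> dvdr a (c * x).
Proof. by move=> [d ->]; exists (c * d); rewrite mulrA. Qed.

Lemma dvdr_mul a b x y : dvdr a x -> dvdr b y -> dvdr (a * b) (x * y).
Proof. by move=> [c ->] [d ->]; exists (c * d); ring. Qed.

Lemma dvdr_subX a x y n : dvdr a (x - y) -> dvdr a (x ^+ n - y ^+ n).
Proof. by move=> axy; rewrite subrXX mulrC; apply: dvdr_mull. Qed.

Lemma dvdr_subM a x y u v :
  dvdr a (x - y) -> dvdr a (u - v) -> dvdr a (x * u - y * v).
Proof.
move=> axy auv.
have ->: x * u - y * v = u * (x - y) + y * (u - v) by ring.
by apply: dvdrD; apply: dvdr_mull.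
Qed.

Lemma dvdr_subrX1 a x n : dvdr a (x - 1) -> dvdr a (x ^+ n - 1).
Proof. by move=> /(dvdr_subX n); rewrite expr1n. Qed.

Lemma dvdr_unit a x : a \is a GRing.unit -> dvdr a x.
Proof. by move=> ua; exists (x / a); rewrite divrK. Qed.

Lemma dvdr_mulVu a b : b != 0 -> dvdr (a * b) b -> a \is a GRing.unit.
Proof.
move=> b0 [c bE]; apply/unitrPr; exists c; apply: (mulIf b0).
by rewrite mul1r [RHS]bE; ring.
Qed.

Lemma comaximal_dvd u a b : dvdr b a -> comaximal u a -> comaximal u b.
Proof. by move=> [c ->] [r [s E]]; exists r, (s * c); rewrite -mulrA. Qed.

Lemma comaximalM u a b : comaximal u a -> comaximal u b -> comaximal u (a * b).
Proof.
move=> [r [s E]] [r' [s' E']]; exists (r * (r' * u + s' * b) + s * a * r').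
exists (s * s'); rewrite -[1]mulr1 -{1}E -E'; ring.
Qed.

Lemma comaximalX u a n : comaximal u a -> comaximal (u ^+ n) a.
Proof.
move=> ua; elim: n => [|n [r [s E]]].
  by exists 1, 0; rewrite expr0; ring.
move: ua => [r' [s' E']]; exists (r * r').
exists (r * u ^+ n * s' + s); rewrite exprS -E -[r * u ^+ n]mulr1 -{2}E'; ring.
Qed.

Lemma comaximal_Gauss u a x : comaximal u a -> dvdr a (u * x) -> dvdr a x.
Proof.
move=> [r [s E]] [c uxE]; exists (r * c + s * x).
by rewrite -[LHS]mul1r -E mulrDl -mulrA uxE; ring.
Qed.

Lemma comaximal0 u : comaximal u 0 -> u \is a GRing.unit.
Proof.
by move=> [r [s]]; rewrite mulr0 addr0 mulrC => ?; apply/unitrPr; exists r.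
Qed.

Lemma comaximal_cong a u v : dvdr a (u - v) -> comaximal v a -> comaximal u a.
Proof.
move=> [c uvE] [r [s E]]; exists r, (s - r * c).
by rewrite -E -[u](subrK v) uvE; ring.
Qed.

(* The conditions on [R / a] used by the construction: its characteristic is
   positive and its units are torsion. Unlike finiteness of [R / a], their
   stability under products needs no counting. *)
Definition torsion_quotient a : Prop :=
  (exists2 q, (0 < q)%N & dvdr a q%:R) /\
  (forall u, comaximal u a -> exists2 k, (0 < k)%N & dvdr a (u ^+ k - 1)).

Lemma torsion_quotientM a b :
  torsion_quotient a -> torsion_quotient b -> torsion_quotient (a * b).
Proof.
move=> [[q q0 aq] ta] [[r r0 br] tb]; split.
  by exists (q * r)%N; rewrite ?muln_gt0 ?q0 // natrM; apply: dvdr_mul.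
move=> u uab.
have [|k k0 ak] := ta u; first by apply: comaximal_dvd uab; exists b; ring.
have [|l l0 bl] := tb u; first by apply: comaximal_dvd uab; exists a; ring.
(* The exponent [k * l] works modulo [a] and modulo [b] separately; as these need not be comaximal,
   the factor [r] is added to reach [a * b]. *)
exists (k * l * r)%N; first by rewrite !muln_gt0 k0 l0.
set v := u ^+ (k * l).
have av : dvdr a (v - 1) by rewrite /v exprM; apply: dvdr_subrX1.
have bv : dvdr b (v - 1) by rewrite /v mulnC exprM; apply: dvdr_subrX1.
(* [v ^ r - 1 = (v - 1)(1 + v + ... + v^(r-1))], where the second factor is
   congruent to [r], hence to [0], modulo [b]. *)
rewrite exprM -/v subrX1; apply: dvdr_mul => //.
rewrite -[\sum_(i < r) _](subrK (r%:R)); apply: dvdrD => //.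
have ->: r%:R = \sum_(i < r) (1 : R) by rewrite sumr_const card_ord.
rewrite -sumrB; apply: big_ind => [|x y|i _]; first exact: dvdr0.
  exact: dvdrD.
exact: dvdr_subrX1.
Qed.

Lemma torsion_quotient_unit a : a \is a GRing.unit -> torsion_quotient a.
Proof. by move=> ua; split=> [|u _]; exists 1%N => //; exact: dvdr_unit. Qed.

(** A repetition among the [i%:R] gives the characteristic; one among the powers of [u] gives the
    exponent, once the smaller power is cancelled. *)
Lemma pigeonhole_torsion_quotient a :
  (forall s : nat -> R, exists i j, (i < j)%N /\ dvdr a (s j - s i)) ->
  torsion_quotient a.
Proof.
move=> pigeon; split=> [|u ua].
  have [i [j [ij aij]]] := pigeon (fun i => i%:R).
  by exists (j - i)%N; rewrite ?subn_gt0 // natrB // ltnW.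
have [i [j [ij aij]]] := pigeon (fun i => u ^+ i).
exists (j - i)%N; rewrite ?subn_gt0 //.
apply: (comaximal_Gauss (comaximalX i ua)).
by rewrite mulrBr mulr1 -exprD subnKC // ltnW.
Qed.

End Divisibility.

(** * Noetherian induction and residue rings of a principal ideal domain *)

Section PrincipalIdeals.
Variable R : idomainType.
Hypothesis hPID : is_PID R.
Implicit Types a b x y : R.

Lemma PID_principal (I : R -> Prop) :
  I 0 -> (forall x y, I x -> I y -> I (x - y)) ->
  (forall a x, I x -> I (a * x)) ->
  exists a, forall x, I x <-> dvdr a x.
Proof.
move=> I0 IB IM; have [|a aP] := hPID (I := [pred x | `[< I x >]]).
  split; last by move=> a x; rewrite !inE => /asboolP Ix; apply/asboolP/IM.
  split; first by rewrite inE; apply/asboolP.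
  by move=> x y; rewrite !inE => /asboolP Ix /asboolP Iy; apply/asboolP/IB.
exists a => x; rewrite -[dvdr a x]aP inE; exact: (rwP (asboolP _)).
Qed.

(** A counterexample would start an infinite chain of strict divisors. The union of the ideals they
    generate is principal, and its generator already lies in one of them, so the chain stops. *)
Lemma PID_ind (P : R -> Prop) :
  (forall a, a != 0 ->
     (forall b, dvdr b a -> ~ dvdr a b -> P b) -> P a) ->
  forall a, a != 0 -> P a.
Proof.
move=> step a a0; apply: contrapT => Pa.
pose bad b := b != 0 /\ ~ P b.
have next b : bad b -> exists c, bad c /\ (dvdr c b /\ ~ dvdr b c).
  move=> [b0 Pb]; apply: contrapT => nex; apply: Pb; apply: step => // c cb bc.
  apply: contrapT => Pc; apply: nex; exists c; split=> //; split=> //.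
  by apply: contraNneq b0 => c0; case: cb => d ->; rewrite c0 mulr0.
have /choice[g gP] : forall b, exists c,
    bad b -> bad c /\ (dvdr c b /\ ~ dvdr b c).
  by move=> b; have [/next [c ?]|nb] := pselect (bad b); [exists c | exists 0].
pose s n := iter n g a.
have bs n : bad (s n) by elim: n => [|n /gP []] //; split.
have sS n : dvdr (s n.+1) (s n) by have [_ []] := gP _ (bs n).
have sD m n : (m <= n)%N -> dvdr (s n) (s m).
  elim: n => [|n IHn]; first by rewrite leqn0 => /eqP ->; exact: dvdrr.
  rewrite leq_eqVlt ltnS => /orP[/eqP ->|/IHn]; first exact: dvdrr.
  exact: dvdr_trans.
have [|x y [m mx] [n ny]|b x [m mx]|d dP] :=
  @PID_principal (fun x => exists n, dvdr (s n) x).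
- by exists 0%N; exact: dvdr0.
- exists (maxn m n); apply: dvdrB.
    by apply: dvdr_trans mx; apply: sD; rewrite leq_maxl.
  by apply: dvdr_trans ny; apply: sD; rewrite leq_maxr.
- by exists m; exact: dvdr_mull.
have [n nd] := (dP d).2 (dvdrr d).
have [_ [_]] := gP _ (bs n); apply.
by apply: dvdr_trans nd _; apply/(dP _).1; exists n.+1; exact: dvdrr.
Qed.

Definition irreducible a : Prop :=
  a \isn't a GRing.unit /\
  forall b c, a = b * c -> b \is a GRing.unit \/ c \is a GRing.unit.

Definition multiples a : {pred R} := [pred x | `[< dvdr a x >]].

Lemma multiplesP a x : reflect (dvdr a x) (x \in multiples a).
Proof. exact: asboolP. Qed.

Lemma multiples_idealr_closed a :
  a \isn't a GRing.unit -> idealr_closed (multiples a).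
Proof.
move=> nua; split; first by apply/multiplesP; exact: dvdr0.
  apply/multiplesP => -[c E]; case/negP: nua; apply/unitrPr.
  by exists c; rewrite mulrC -E.
move=> b x y /multiplesP ax /multiplesP ay; apply/multiplesP/dvdrD => //.
exact: dvdr_mull.
Qed.

Lemma irreducible_torsion_quotient a :
  (forall m : idealr R, maximal_ideal m -> finite_quotient m) ->
  irreducible a -> torsion_quotient a.
Proof.
move=> hfin [nua irr].
pose mixin := isIdealr.Build R (multiples a) (multiples_idealr_closed nua).
pose m : idealr R := HB.pack (multiples a) mixin.
have maxm : maximal_ideal m.
  move=> J mJ x xJ.
  have [|d dP] := hPID (I := J).
    split; last by move=> b y; exact: idealMr.
    by split=> [|y z]; [exact: rpred0 | exact: rpredB].
  have /(dP _).1[b aE] : a \in J by apply: mJ; apply/multiplesP/dvdrr.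
  (* If [b] is a unit, [J] is generated by [a]; if [d] is, [J] contains 1, which [idealr]
     excludes. *)
  have [ub|ud] := irr _ _ aE.
    apply/multiplesP; apply: (dvdr_trans (b := d)).
      by exists b^-1; rewrite aE mulKr.
    exact/(dP _).1.
  have : 1 \in J by apply/(dP _).2; exists d^-1; rewrite mulVr.
  by rewrite idealr1.
have [e eP] := hfin m maxm.
apply: pigeonhole_torsion_quotient => s.
pose p i := \pi_({ideal_quot m})%qT (s i).
(* Of [(size e).+1] terms, two share a class, since [e] lists all classes. *)
have [inj|] := boolP (uniq [seq p i | i <- iota 0 (size e).+1]).
  have /(uniq_leq_size inj) : {subset [seq p i | i <- iota 0 (size e).+1] <= e}.
    by move=> z _; rewrite -has_pred1 has_count eP.
  by rewrite size_map size_iota ltnn.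
move/(uniqPn (p 0%N)) => [i [j [ij]]]; rewrite size_map size_iota => js.
rewrite !(nth_map 0%N) ?size_iota ?(ltn_trans ij) // !nth_iota ?(ltn_trans ij) //.
rewrite !add0n => pij; exists i, j; split=> //.
by apply/multiplesP; rewrite (Quotient.idealrBE m); apply/eqP.
Qed.

(** Induction on strict divisors: a reducible nonunit is a product of two of them. *)
Lemma nonzero_torsion_quotient a :
  (forall m : idealr R, maximal_ideal m -> finite_quotient m) ->
  a != 0 -> torsion_quotient a.
Proof.
move=> hfin; move: a; apply: PID_ind => a a0 IHa.
have [ua|nua] := boolP (a \is a GRing.unit); first exact: torsion_quotient_unit.
have [irr|nirr] := pselect (irreducible a).
  exact: irreducible_torsion_quotient.
have [b [c [aE nub nuc]]] : exists b c,
    [/\ a = b * c, b \isn't a GRing.unit & c \isn't a GRing.unit].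
  apply: contrapT => nex; apply: nirr; split=> // b c aE.
  have [ub|nub] := boolP (b \is a GRing.unit); first by left.
  right; apply: contrapT => /negP nuc.
  by apply: nex; exists b, c.
have [b0 c0] : b != 0 /\ c != 0.
  by apply/andP; rewrite -negb_or -mulf_eq0 -aE.
rewrite aE; apply: torsion_quotientM; apply: IHa.
- by exists c; rewrite mulrC.
- by rewrite aE mulrC => /(dvdr_mulVu b0); apply/negP.
- by exists b.
- by rewrite aE => /(dvdr_mulVu c0); apply/negP.
Qed.

End PrincipalIdeals.

(** * Values of forms at coprime points *)

Section Forms.
Variables (R : idomainType) (n : nat).
Implicit Types (x y : n.-tuple R) (c : 'I_n -> R) (f g : {mpoly R[n]}).

Definition dotp c x := \sum_(i < n) c i * tnth x i.

Definition linear_form c : {mpoly R[n]} := \sum_(i < n) c i *: 'X_i.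

Lemma linear_form_homog c : linear_form c \is 1.-homog.
Proof.
apply: rpred_sum => i _; apply: dhomogZ.
by rewrite dhomogX /= mdeg1.
Qed.

Lemma linear_formE c x : (linear_form c).@[tnth x] = dotp c x.
Proof.
rewrite raddf_sum; apply: eq_bigr => i _.
by rewrite /= mevalZ mevalXU.
Qed.

Lemma coprime_entriesP x : coprime_entries x -> exists c, dotp c x = 1.
Proof. by move=> /(_ 1) [a E]; exists (tnth a). Qed.

Lemma meval_cong_scale b l x y d f :
  f \is d.-homog -> (forall i, dvdr b (tnth y i - l * tnth x i)) ->
  dvdr b (f.@[tnth y] - l ^+ d * f.@[tnth x]).
Proof.
move=> fd yx; rewrite !mevalE big_distrr /= -sumrB big_seq.
apply: big_ind => [||m mf]; [exact: dvdr0|exact: dvdrD|].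
rewrite mulrCA -mulrBr; apply: dvdr_mull.
(* As [m] has degree [d], [l ^+ d] splits into the powers [l ^+ m i], one per variable, and the
   products are compared factor by factor. *)
rewrite -(dhomog_mf fd mf) /= mdegE -prodrXr -big_split /=.
apply: (big_ind2 (fun u v => dvdr b (u - v))) => [|u v u' v'|i _].
- by rewrite subrr; exact: dvdr0.
- exact: dvdr_subM.
- by rewrite -exprMn; exact: dvdr_subX.
Qed.

Hypothesis hPID : is_PID R.

Lemma separating_linear_form x y :
  coprime_entries x -> coprime_entries y ->
  exists c, dotp c x = 0 /\
    forall d f, f \is d.-homog -> f.@[tnth x] \is a GRing.unit ->
      comaximal f.@[tnth y] (dotp c y).
Proof.
move=> /coprime_entriesP[p px] /coprime_entriesP[q qy].
pose I r := exists2 c, dotp c x = 0 & r = dotp c y.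
have dotpB c c' z : dotp (fun i => c i - c' i) z = dotp c z - dotp c' z.
  by rewrite -sumrB; apply: eq_bigr => i _; rewrite mulrBl.
have dotpZ a c z : dotp (fun i => a * c i) z = a * dotp c z.
  by rewrite /dotp mulr_sumr; apply: eq_bigr => i _; rewrite mulrA.
have dotpU k z : dotp (fun i => (i == k)%:R) z = tnth z k.
  rewrite /dotp (bigD1 k) //= eqxx mul1r big1 ?addr0 // => i /negPf ->.
  by rewrite mul0r.
have [|r r' [c cx ->] [c' cx' ->]|a r [c cx ->]|b bP] := PID_principal hPID (I := I).
- exists (fun=> 0); rewrite /dotp big1 // => i _; exact: mul0r.
- by exists (fun i => c i - c' i); rewrite dotpB // cx cx' subr0.
- by exists (fun i => a * c i); rewrite dotpZ // cx mulr0.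
have [c cx bE] := (bP b).2 (dvdrr b).
exists c; split=> // d f fd ufx; rewrite -bE.
set l := dotp p y.
have yx k : dvdr b (tnth y k - l * tnth x k).
  (* The [k]-th coordinate minus [tnth x k] times the form [p] vanishes at [x], because [p] takes
     the value 1 there. *)
  apply/(bP _).1; exists (fun i => (i == k)%:R - tnth x k * p i).
    by rewrite dotpB dotpZ dotpU px mulr1 subrr.
  by rewrite dotpB dotpZ dotpU mulrC.
(* Applying [q] to the congruence between [y] and [l] times [x] gives [l * dotp q x] congruent to
   1. *)
have lb : comaximal l b.
  have [e eE] : dvdr b (dotp q y - l * dotp q x).
    rewrite /dotp mulr_sumr -sumrB; apply: big_ind => [||k _].
    - exact: dvdr0.
    - exact: dvdrD.
    - by rewrite mulrCA -mulrBr; apply: dvdr_mull.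
  exists (dotp q x), e; rewrite -eE qy; ring.
apply: comaximal_cong (meval_cong_scale fd yx) _.
have [r [s E]] := comaximalX d lb.
exists (r / f.@[tnth x]), s; rewrite -E; congr (_ + _).
by rewrite mulrCA divrK // mulrC.
Qed.

(** One linear form is spent per point, which fixes the degree; comaximality passes to the product
    of their values at [y]. *)
Lemma separating_form (s : seq (n.-tuple R)) y d f :
  coprime_entries y -> f \is d.-homog ->
  (forall x, x \in s -> coprime_entries x /\ f.@[tnth x] \is a GRing.unit) ->
  exists g, [/\ g \is (size s).-homog, forall x, x \in s -> g.@[tnth x] = 0 &
    comaximal f.@[tnth y] g.@[tnth y]].
Proof.
move=> cy fd; elim: s => [|x s IHs] sP.
  exists 1; split=> //; first exact: dhomog1.
  by exists 0, 1; rewrite meval1 mul0r mul1r add0r.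
have [z zs|g [gs g0 gy]] := IHs; first by apply: sP; rewrite inE zs orbT.
have [cx ufx] := sP x (mem_head _ _).
have [c [c0 cP]] := separating_linear_form cx cy.
exists (linear_form c * g); split.
- exact: (dhomogM (linear_form_homog c) gs).
- move=> z; rewrite inE mevalM linear_formE => /predU1P[->|/g0 ->].
    by rewrite c0 mul0r.
  by rewrite mulr0.
- by rewrite mevalM linear_formE; apply: comaximalM (cP _ _ fd ufx) gy.
Qed.

End Forms.

Theorem theorem0p3 (R : idomainType) (hPID : is_PID R)
  (hfin : forall m : idealr R, maximal_ideal m -> finite_quotient m) :
  enough_homogeneous_polynomials R.
Proof.
move=> n n1 S SP.
suff H (s : seq (n.-tuple R)) : (forall x, x \in s -> coprime_entries x) ->
    exists (d : nat) (f : {mpoly R[n]}), [/\ (1 <= d)%N, f \is d.-homog &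
      forall x, x \in s -> f.@[tnth x] \is a GRing.unit].
  exact: (H (enum_fset S)).
elim: s => [|y s IHs] sP.
  (* With no points to check, the zero form counts as a form of degree 1. *)
  by exists 1%N, (linear_form (fun=> 0)); split=> //; exact: linear_form_homog.
have cs x : x \in s -> coprime_entries x.
  by move=> xs; apply: sP; rewrite inE xs orbT.
have [d [f [d1 fd fs]]] := IHs cs.
have cy := sP y (mem_head _ _).
have [|g [gs g0 gy]] := separating_form hPID (s := s) cy fd.
  by move=> x xs; split; [exact: cs | exact: fs].
have [a0|a0] := eqVneq (g.@[tnth y]) 0.
  exists d, f; split=> // x; rewrite inE => /predU1P[->|/fs //].
  by apply: comaximal0; rewrite -a0.
have [_ /(_ _ gy)[k k0 gk]] := nonzero_torsion_quotient hPID hfin a0.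
have [l ly] := coprime_entriesP cy.
(* [e] is the degree of the power of [f] used below. The factor [(size s).+1] makes it at least the
   degree of [g], so that powers of [l] can pad [g] to degree [e]. *)
pose e := (d * (k * (size s).+1))%N.
have se : (size s <= e)%N.
  by rewrite /e mulnA (leq_trans (leqnSn _)) // leq_pmull // muln_gt0 d1.
have [c cE] : dvdr g.@[tnth y] (f.@[tnth y] ^+ (k * (size s).+1) - 1).
  by rewrite exprM; apply: dvdr_subrX1.
exists e, (f ^+ (k * (size s).+1) - c *: (g * linear_form l ^+ (e - size s))).
split.
- by rewrite !muln_gt0 d1 k0.
- apply: rpredB; first exact: dhomogMn.
  apply: dhomogZ.
  have := dhomogM gs (dhomogMn (e - size s) (linear_form_homog l)).
  by rewrite mul1n subnKC.
(* On [s] the correction vanishes and a power of a unit remains; at [y] it subtracts exactly the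
   excess over 1. *)
- move=> x; rewrite mevalB mevalZ mevalM !rmorphXn /= linear_formE inE.
  move=> /predU1P[->|xs]; last by rewrite g0 // mul0r mulr0 subr0 unitrX // fs.
  by rewrite ly expr1n mulr1 -cE subKr unitr1.
Qed.
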